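(* Let $x,y>0$ be fixed. For $r,s\in\mathbb{R}$ let $G(r,s;x,y)$ denote the Gini mean, that is, $G(r,s;x,y)=\left(\frac{x^s+y^s}{x^r+y^r}\right)^{1/(s-r)}$ if $r\neq s$, and $G(r,r;x,y)=\exp\left(\frac{x^r\ln x+y^r\ln y}{x^r+y^r}\right)$. Then: (1) $G(r,s;x,y)$ is increasing with respect to both $r\in(-\infty,\infty)$ and $s\in(-\infty,\infty)$, i.e. it is increasing in each of the two variables $r$ and $s$ when the other is held fixed; (2) $G(r,s;x,y)$ is logarithmically convex with respect to both $r$ and $s$ (in each of the two variables with the other held fixed) for $(r,s)\in(-\infty,0)\times(-\infty,0)$; (3) $G(r,s;x,y)$ is logarithmically concave with respect to both $r$ and $s$ (in each of the two variables with the other held fixed) for $(r,s)\in(0,\infty)\times(0,\infty)$.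
   Context: ''Increasing'' means nondecreasing (non-strict). A positive function $f$ on an interval is logarithmically convex (respectively, logarithmically concave) if $\ln f$ is convex (respectively, concave) there, in the non-strict sense. *)

(* Defs.v *)
From mathcomp Require Import all_boot all_order all_algebra.
From mathcomp Require Import all_classical all_reals all_analysis.

Set Implicit Arguments.
Unset Strict Implicit.
Unset Printing Implicit Defensive.

Import Order.TTheory GRing.Theory Num.Theory.

Local Open Scope classical_set_scope.
Local Open Scope ring_scope.
Local Open Scope convex_scope.

Definition gini {R : realType} (r s x y : R) : R :=
  if r == s then
    expR ((x `^ r * ln x + y `^ r * ln y) / (x `^ r + y `^ r))
  else ((x `^ s + y `^ s) / (x `^ r + y `^ r)) `^ (1 / (s - r)).

(* Mirror image of [convex_function]. *)
Definition concave_function (R : numFieldType) (E : lmodType R)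
    (E' := convex_lmodType E) (D : set E') (f : E' -> R^o) :=
  forall t : {i01 R},
    {in D &, forall x y : E', f x <| t |> f y <= f (x <| t |> y)}.

(* Positivity is part of both notions below because [ln] takes the junk
   value 0 on nonpositive arguments. *)
Definition log_convex {R : realType} (D : set R) (f : R -> R) : Prop :=
  (forall z, D z -> 0 < f z) /\ convex_function (E := R^o) D (fun z => ln (f z)).

Definition log_concave {R : realType} (D : set R) (f : R -> R) : Prop :=
  (forall z, D z -> 0 < f z) /\ concave_function (E := R^o) D (fun z => ln (f z)).

(* Main.v *)
(** Put [phi t = ln (x ^ t + y ^ t)].  Then [ln (gini r s x y)] is the mean of
    [phi'] over the segment from [r] to [s], hence increasing in each variable
    since [phi'' >= 0].  Since [phi''] is decreasing on [0, +oo[, [phi'] is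
    concave there, and so is its mean over the segment in each variable.  The
    reflection [phi (- t) = phi t - t * ln (x * y)] turns this concavity into
    convexity for negative parameters. *)

Require Import Defs.
From mathcomp Require Import all_boot all_order all_algebra.
From mathcomp Require Import all_classical all_reals all_analysis.
From mathcomp Require Import ring lra.

Import Order.TTheory GRing.Theory Num.Theory.
Import numFieldNormedType.Exports.

Local Open Scope classical_set_scope.
Local Open Scope ring_scope.

(** * Consequences of the mean value theorem *)

Lemma le_of_is_derive_ge0 (R : realType) (f f' : R -> R) (a b : R) :
  a <= b -> (forall u : R, is_derive u 1 f (f' u)) ->
  (forall u, a <= u <= b -> 0 <= f' u) -> f a <= f b.
Proof.
move=> ab df f'0.
have cf : {within `[a, b], continuous f}.
  by apply: derivable_within_continuous => u _; have [] := df u.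
have [c + e] := MVT_segment ab (fun u _ => df u) cf.
by rewrite in_itv/= => /f'0 ?; rewrite -subr_ge0 e mulr_ge0// subr_ge0.
Qed.

(** Concavity in tangent form: the chord from [m] to [p] has slope [f' c] with [c] between them, and
    [f' c] compares with [f' m] according to the side of [m] on which [p] lies. *)
Lemma le_tangent (R : realType) (f f' : R -> R) (x0 m p : R) :
  (forall t : R, is_derive t 1 f (f' t)) ->
  (forall t u, x0 < t -> t <= u -> f' u <= f' t) ->
  x0 < m -> x0 < p -> f p <= f m + f' m * (p - m).
Proof.
move=> df antif' m0 p0; rewrite addrC -lerBlDr.
have cf (u v : R) : {within `[u, v], continuous f}.
  by apply: derivable_within_continuous => w _; have [] := df w.
have [mp|/ltW pm] := leP m p.
- have [c] := MVT_segment mp (fun u _ => df u) (cf m p).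
  rewrite in_itv/= => /andP[mc cp] ->.
  by rewrite ler_wpM2r ?subr_ge0// antif'.
- have [c] := MVT_segment pm (fun u _ => df u) (cf p m).
  rewrite in_itv/= => /andP[pc cm] e.
  rewrite -[leLHS]opprB e -mulrN opprB -subr_le0 -mulrBl.
  by rewrite mulr_ge0_le0 ?subr_le0// subr_ge0 antif'// (lt_le_trans p0).
Qed.

(** * The logarithm of a sum of two exponentials and its derivatives *)

Section log_sum_exp.
Variables (R : realType) (a b : R).

(** With [a = ln x] and [b = ln y] this is x^t + y^t. *)
Definition sumexp (t : R) : R := expR (t * a) + expR (t * b).

Definition dlnsumexp (t : R) : R :=
  (expR (t * a) * a + expR (t * b) * b) / sumexp t.

(** The second derivative (a - b)^2 A B / (A + B)^2, where A = e^(ta) and B = e^(tb), with numerator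
    and denominator divided by A B. Then [t] enters only through E + 1/E, where E = A/B. *)
Definition ddlnsumexp (t : R) : R :=
  (a - b) ^+ 2 / (2 + expR (t * (a - b)) + (expR (t * (a - b)))^-1).

Lemma sumexp_gt0 t : 0 < sumexp t.
Proof. by rewrite addr_gt0// expR_gt0. Qed.

Lemma is_derive_expRM (c t : R) :
  is_derive t 1 (fun t : R => expR (t * c)) (expR (t * c) * c).
Proof.
have dl : is_derive t 1 (fun t : R => t * c) c.
  rewrite (_ : (fun t => t * c) = c \*: id); last first.
    by apply/funext => u /=; rewrite mulrC.
  by apply: is_derive_eq; rewrite /GRing.scale/= mulr1.
exact: (@is_derive1_comp _ expR ( *%R^~ c) _ _ _ (is_derive_expR _) dl).
Qed.

Lemma is_derive_sumexp (t : R) :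
  is_derive t 1 sumexp (expR (t * a) * a + expR (t * b) * b).
Proof. exact: is_deriveD (is_derive_expRM a t) (is_derive_expRM b t). Qed.

Lemma is_derive_lnsumexp (t : R) :
  is_derive t 1 (fun t => ln (sumexp t)) (dlnsumexp t).
Proof.
rewrite /dlnsumexp mulrC.
exact: is_derive1_comp (is_derive1_ln (sumexp_gt0 t)) (is_derive_sumexp t).
Qed.

(** Dividing through by [expR (t * a)] leaves a single exponential, which is easier to differentiate
    and to reflect. *)
Lemma dlnsumexpE t : dlnsumexp t = b + (a - b) / (1 + expR (t * (b - a))).
Proof.
rewrite /dlnsumexp /sumexp mulrBr expRD expRN.
have := expR_gt0 (t * a); have := expR_gt0 (t * b).
move: (expR _) (expR _) => B A B0 A0; field.
by rewrite !gt_eqF// addr_gt0.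
Qed.

Lemma is_derive_dlnsumexp (t : R) : is_derive t 1 dlnsumexp (ddlnsumexp t).
Proof.
pose q t := 1 + expR (t * (b - a)).
have q0 u : q u != 0 by rewrite gt_eqF// addr_gt0// expR_gt0.
have -> : dlnsumexp = cst b + (a - b) \*: (fun u => (q u)^-1).
  by apply/funext => u; rewrite dlnsumexpE.
have dq : is_derive t 1 q (expR (t * (b - a)) * (b - a)).
  have := is_deriveD (is_derive_cst (1 : R) t 1) (is_derive_expRM (b - a) t).
  by rewrite add0r.
have dV := is_deriveV (q0 t) dq.
apply: (is_derive_eq (is_deriveD (is_derive_cst b t 1) (is_deriveZ (a - b) dV))).
rewrite add0r /ddlnsumexp /GRing.scale/= /q.
rewrite -[b - a]opprB mulrN expRN.
have := expR_gt0 (t * (a - b)).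
move: (expR _) => E E0; field.
by rewrite !gt_eqF//; nra.
Qed.

Lemma ddlnsumexp_ge0 t : 0 <= ddlnsumexp t.
Proof.
by rewrite divr_ge0 ?sqr_ge0// !addr_ge0// ?invr_ge0 expR_ge0.
Qed.

Lemma ddlnsumexp_anti (t u : R) : 0 < t -> t <= u -> ddlnsumexp u <= ddlnsumexp t.
Proof.
move=> t0 tu; rewrite ler_wpM2l ?sqr_ge0// lef_pV2 ?posrE; last 2 first.
- by rewrite !addr_gt0// ?invr_gt0 expR_gt0.
- by rewrite !addr_gt0// ?invr_gt0 expR_gt0.
rewrite -!addrA !lerD2l.
(* E + 1/E is invariant under inversion of E, so [a - b] may be replaced by its absolute value. The
   exponentials are then at least 1, where E + 1/E is nondecreasing. *)
have sym v : expR (v * (a - b)) + (expR (v * (a - b)))^-1 =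
    expR (v * `|a - b|) + (expR (v * `|a - b|))^-1.
  by case: ger0P => // _; rewrite mulrN expRN invrK addrC.
rewrite (sym t) (sym u).
have : 1 <= expR (t * `|a - b|) by rewrite -expR0 ler_expR mulr_ge0// ltW.
have : expR (t * `|a - b|) <= expR (u * `|a - b|) by rewrite ler_expR ler_wpM2r.
move: (expR (t * _)) (expR (u * _)) => E F EF E1.
rewrite -subr_ge0.
have -> : F + F^-1 - (E + E^-1) = (F - E) * (1 - (E * F)^-1).
  by field; rewrite !gt_eqF//; lra.
have F1 : 1 <= F by exact: le_trans EF.
by rewrite mulr_ge0 ?subr_ge0// invf_le1 ?mulr_ege1// mulr_gt0//; lra.
Qed.

Lemma dlnsumexp_homo (t u : R) : t <= u -> dlnsumexp t <= dlnsumexp u.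
Proof.
move=> tu; apply: (@le_of_is_derive_ge0 _ _ _ _ _ tu is_derive_dlnsumexp).
by move=> *; exact: ddlnsumexp_ge0.
Qed.

Lemma dlnsumexp_concave (l t u : R) : 0 <= l <= 1 -> 0 < t -> 0 < u ->
  l * dlnsumexp t + (1 - l) * dlnsumexp u <= dlnsumexp (l * t + (1 - l) * u).
Proof.
move=> /andP[l0 l1] t0 u0.
set m := l * t + _.
have m0 : 0 < m by rewrite /m; nra.
have tan p := @le_tangent _ _ _ 0 m p is_derive_dlnsumexp ddlnsumexp_anti m0.
(* Averaging the tangent bounds at [m] cancels the linear terms, since l (t - m) + (1 - l) (u - m) =
   0. *)
apply: le_trans (lerD (ler_wpM2l l0 (tan t t0)) (ler_wpM2l _ (tan u u0))) _.
  by rewrite subr_ge0.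
by rewrite le_eqVlt; apply/orP; left; apply/eqP; rewrite /m; ring.
Qed.

Lemma dlnsumexpN t : dlnsumexp (- t) = a + b - dlnsumexp t.
Proof.
rewrite !dlnsumexpE mulNr expRN.
have := expR_gt0 (t * (b - a)); move: (expR _) => E E0; field.
by rewrite !gt_eqF//; lra.
Qed.

(** This is 1/A + 1/B = (A + B) / (A B) in logarithmic form. *)
Lemma lnsumexpN t : ln (sumexp (- t)) = ln (sumexp t) - t * (a + b).
Proof.
apply: (@expR_inj R); rewrite expRD !lnK ?posrE ?sumexp_gt0//.
rewrite /sumexp !mulNr !expRN mulrDr expRD.
have := expR_gt0 (t * a); have := expR_gt0 (t * b).
move: (expR _) (expR _) => B A B0 A0; field.
by rewrite !gt_eqF.
Qed.

(** * Divided differences of [ln (sumexp t)], extended to the diagonal *)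

Definition slope (r s : R) : R :=
  if r == s then dlnsumexp r else (ln (sumexp s) - ln (sumexp r)) / (s - r).

Lemma slopeC r s : slope r s = slope s r.
Proof.
rewrite /slope [s == r]eq_sym; case: eqVneq => [->//|rs].
by rewrite -mulrNN -invrN !opprB.
Qed.

Lemma slopeN r s : slope (- r) (- s) = a + b - slope r s.
Proof.
rewrite /slope eqr_opp; case: eqVneq => [_|rs]; first exact: dlnsumexpN.
rewrite (lnsumexpN r) (lnsumexpN s).
move: (ln _) (ln _) => Ls Lr; field.
by rewrite opprK [- s + r]addrC !subr_eq0 eq_sym rs.
Qed.

(* [P 1 - P 0] is the integral of [dlnsumexp] along the segment from [r] to [s]. *)
Lemma slope_primitive r s : exists2 P : R -> R,
  forall u : R, is_derive u 1 P (dlnsumexp (r + u * (s - r))) &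
  slope r s = P 1 - P 0.
Proof.
have daff (c d u : R) : is_derive u 1 (fun u => c + u * d) d.
  rewrite (_ : (fun u => c + u * d) = cst c + d \*: id); last first.
    by apply/funext => v; rewrite /= mulrC.
  apply: (is_derive_eq
    (is_deriveD (is_derive_cst c u 1) (is_deriveZ d (is_derive_id u 1)))).
  by rewrite add0r /GRing.scale/= mulr1.
rewrite /slope; case: eqVneq => [<-|rs].
  (* On the diagonal the integrand is constant; the summand 0 gives the primitive the shape of
     [daff]. *)
  exists (fun u => 0 + u * dlnsumexp r); last by ring.
  by move=> u; rewrite subrr mulr0 addr0; exact: daff.
(* The factor [(s - r)^-1] cancels the [s - r] produced by the chain rule. *)
exists ((s - r)^-1 \*: (fun u => ln (sumexp (r + u * (s - r))))).
  move=> u; apply: is_derive_eq.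
    apply: is_deriveZ.
    exact: (is_derive1_comp (is_derive_lnsumexp _) (daff r (s - r) u)).
  by rewrite /GRing.scale/= mulrC mulfK// subr_eq0 eq_sym.
by rewrite /GRing.scale/= mul0r addr0 mul1r [r + _]addrC subrK -mulrBr mulrC.
Qed.

(** For [v] in [0, 1] the point t + v (s - t) is nondecreasing in [t], so the integrands are ordered
    pointwise. The difference of the primitives is therefore nondecreasing on [0, 1]. *)
Lemma slope_homo s : {homo slope^~ s : t u / t <= u}.
Proof.
move=> t u tu.
have [P dP ->] := slope_primitive t s; have [Q dQ ->] := slope_primitive u s.
suff : Q 0 - P 0 <= Q 1 - P 1 by lra.
apply: (@le_of_is_derive_ge0 _ (Q - P) (fun v =>
    dlnsumexp (u + v * (s - u)) - dlnsumexp (t + v * (s - t))) 0 1 ler01).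
by move=> v /andP[v0 v1]; rewrite /= subr_ge0 dlnsumexp_homo//; nra.
Qed.

Lemma slope_concave (s l t u : R) : 0 < s -> 0 <= l <= 1 -> 0 < t -> 0 < u ->
  l * slope t s + (1 - l) * slope u s <= slope (l * t + (1 - l) * u) s.
Proof.
move=> s0 /andP[l0 l1] t0 u0.
have [P dP ->] := slope_primitive t s; have [Q dQ ->] := slope_primitive u s.
have [M dM ->] := slope_primitive (l * t + (1 - l) * u) s.
suff : M 0 - (l * P 0 + (1 - l) * Q 0) <= M 1 - (l * P 1 + (1 - l) * Q 1).
  by lra.
set m := l * t + _ in dM *.
apply: (@le_of_is_derive_ge0 _ (M - (l \*: P + (1 - l) \*: Q)) (fun v =>
    dlnsumexp (m + v * (s - m)) - (l *: dlnsumexp (t + v * (s - t)) +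
      (1 - l) *: dlnsumexp (u + v * (s - u)))) 0 1 ler01).
move=> v /andP[v0 v1]; rewrite /= /GRing.scale/= subr_ge0.
(* For fixed [v] the point on the segment is affine in its starting point, so concavity of
   [dlnsumexp] applies pointwise in [v]; all points stay positive. *)
have -> : m + v * (s - m) = l * (t + v * (s - t)) + (1 - l) * (u + v * (s - u)).
  by rewrite /m; ring.
by apply: dlnsumexp_concave; [rewrite l0|nra|nra].
Qed.

End log_sum_exp.

(** * Transfer to Gini means *)

Section gini.
Variables (R : realType) (x y : R).
Hypotheses (x0 : 0 < x) (y0 : 0 < y).

Lemma giniE r s : gini r s x y = expR (slope R (ln x) (ln y) r s).
Proof.
have sumE t : x `^ t + y `^ t = sumexp R (ln x) (ln y) t.
  (* [powR] treats base 0 separately; positivity of [x] and [y] leaves only the exponential case. *)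
  by rewrite /powR !gt_eqF.
rewrite /gini /slope; case: eqVneq => [_|rs].
  by rewrite /dlnsumexp sumE /powR !gt_eqF.
rewrite !sumE /powR gt_eqF ?divr_gt0 ?sumexp_gt0//.
by rewrite ln_div ?posrE ?sumexp_gt0// mul1r mulrC.
Qed.

Lemma giniC r s : gini r s x y = gini s r x y.
Proof. by rewrite !giniE slopeC. Qed.

Lemma gini_homo s : {homo (fun r => gini r s x y) : t u / t <= u}.
Proof. by move=> t u tu; rewrite !giniE ler_expR slope_homo. Qed.

Lemma gini_log_concave s : 0 < s ->
  log_concave `]0, +oo[%classic (fun r => gini r s x y).
Proof.
move=> s0; split=> [r _|l t u]; first by rewrite giniE expR_gt0.
rewrite !inE/= !in_itv/= !andbT => t0 u0.
rewrite !giniE !expRK !convRE.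
by apply: slope_concave => //; rewrite ge0 le1.
Qed.

Lemma gini_log_convex s : s < 0 ->
  log_convex `]-oo, 0[%classic (fun r => gini r s x y).
Proof.
move=> s0; split=> [r _|l t u]; first by rewrite giniE expR_gt0.
rewrite !inE/= !in_itv/= => t0 u0.
rewrite !giniE !expRK !convRE.
(* Concavity at the reflected, positive parameters: [slopeN] reverses the inequality, and the
   constant [ln x + ln y] cancels because the weights sum to 1. *)
have := @slope_concave R (ln x) (ln y) (- s) l%:num (- t) (- u).
rewrite !oppr_gt0 ge0 le1 !mulrN -opprD !slopeN => /(_ s0 isT t0 u0).
rewrite -[conv l t u]/(l%:num * t + (1 - l%:num) * u) /GRing.scale/=.
by rewrite /unstable.onem; lra.
Qed.

End gini.

Theorem theorem1 (R : realType) (x y : R) (hx : 0 < x) (hy : 0 < y) :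
  ((forall s : R, nondecreasing_fun (fun r : R => gini r s x y)) /\
   (forall r : R, nondecreasing_fun (fun s : R => gini r s x y))) /\
  ((forall s : R, s < 0 ->
      log_convex `]-oo, 0[%classic (fun r : R => gini r s x y)) /\
   (forall r : R, r < 0 ->
      log_convex `]-oo, 0[%classic (fun s : R => gini r s x y))) /\
  ((forall s : R, 0 < s ->
      log_concave `]0, +oo[%classic (fun r : R => gini r s x y)) /\
   (forall r : R, 0 < r ->
      log_concave `]0, +oo[%classic (fun s : R => gini r s x y))).
Proof.
(* Symmetry of the mean reduces every claim about the second parameter to the first. *)
have giniCfun r : (fun s => gini r s x y) = (fun s => gini s r x y).
  by apply/funext => s; exact: giniC.
split; [|split]; split=> s.
- exact: gini_homo.
- by rewrite giniCfun; exact: gini_homo.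
- exact: gini_log_convex.
- by rewrite giniCfun; exact: gini_log_convex.
- exact: gini_log_concave.
- by rewrite giniCfun; exact: gini_log_concave.
Qed.
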